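(* Let $m$ be a nonnegative integer and let $f:[-1,1]\to\mathbb{R}$ be such that $f,f',\ldots,f^{(m-1)}$ are absolutely continuous on $[-1,1]$ and $f^{(m)}$ is of bounded variation on $[-1,1]$, i.e. $V_m=\mathcal{V}(f^{(m)},[-1,1])<\infty$. Let $a_n=(n+\frac12)\int_{-1}^1f(x)P_n(x)\,\mathrm{d}x$ be the Legendre coefficients of $f$. Then, for each $n\ge m+1$, $$|a_n|\le\frac{2V_m}{\sqrt{2\pi(n-m)}}\prod_{k=1}^{m}\frac{1}{n-k+1/2},$$ where the product is taken to be one when $m=0$.
   Context: $P_n(x)$ denotes the Legendre polynomial of degree $n$, normalized by $P_n(1)=1$. The total variation of a function $g$ on $[-1,1]$ is $\mathcal{V}(g,[-1,1])=\sup\sum_{j=1}^{N}|g(x_j)-g(x_{j-1})|$, the supremum being over all partitions $-1=x_0<x_1<\cdots<x_N=1$. When $m=0$ the absolute continuity condition is empty. When $m\ge1$, the derivative $f^{(m)}$ of the absolutely continuous function $f^{(m-1)}$ exists almost everywhere; that $f^{(m)}$ is of bounded variation means that it coincides almost everywhere with a function on $[-1,1]$ of bounded variation (again denoted $f^{(m)}$), and $V_m$ is the total variation of that function. *)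

(* Defs.v *)
From HB Require Import structures.
From mathcomp Require Import all_boot all_order all_algebra.
From mathcomp Require Import ring.
From mathcomp Require Import all_classical all_reals all_analysis.

Set Implicit Arguments.
Unset Strict Implicit.
Unset Printing Implicit Defensive.

Import Order.TTheory GRing.Theory Num.Theory.
Import numFieldNormedType.Exports.

Local Open Scope classical_set_scope.
Local Open Scope ring_scope.

(* A function on a closed interval [a, b] is represented by a total function
   R -> R, whose values outside [a, b] play no role. *)

Definition abs_continuous (R : realType) (a b : R) (f : R -> R) : Prop :=
  forall e : R, 0 < e -> exists2 d : R, 0 < d &
    forall (n : nat) (s t : 'I_n -> R),
      (forall i, a <= s i /\ s i <= t i /\ t i <= b) ->
      trivIset setT (fun i => `]s i, t i[%classic) ->
      \sum_(i < n) (t i - s i) < d ->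
      \sum_(i < n) `|f (t i) - f (s i)| < e.

(* Difference quotient of f at x, along the points y of [a, b] tending to x,
   y != x: the limit is two-sided when a < x < b and one-sided at a and b. *)
Definition diff_quotient_on (R : realType) (a b : R) (f : R -> R) (x : R) :=
  (f y - f x) / (y - x) @[y --> within `[a, b] x^'].

Definition derivable_on (R : realType) (a b : R) (f : R -> R) : Prop :=
  forall x, x \in `[a, b] -> cvg (diff_quotient_on a b f x).

Definition derive_on (R : realType) (a b : R) (f : R -> R) : R -> R :=
  fun x => lim (diff_quotient_on a b f x).

Definition nderive_on (R : realType) (a b : R) (k : nat) (f : R -> R) : R -> R :=
  iter k (derive_on a b) f.

(* For m >= 1 the derivative of f^(m-1) is only required to exist, and to agree
   with g, almost everywhere; for m = 0 there is no derivative to take and g is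
   f itself. *)
Definition is_nderive_ae (R : realType) (a b : R) (m : nat) (f g : R -> R)
    : Prop :=
  if m is k.+1 then
    {ae (@lebesgue_measure R), forall x, x \in `[a, b] ->
       diff_quotient_on a b (nderive_on a b k f) x --> g x}
  else {in `[a, b], f =1 g}.

(* Rodrigues' formula *)
Definition legendre (R : realType) (n : nat) : {poly R} :=
  (2 ^+ n * n`!%:R)^-1 *: (('X^2 - 1) ^+ n)^`(n).

Definition legendre_coef (R : realType) (f : R -> R) (n : nat) : R :=
  (n%:R + 2^-1) *
  \int[@lebesgue_measure R]_(x in `[-1, 1]) (f x * (legendre R n).[x]).

Lemma size_legendre (R : realType) (n : nat) : size (legendre R n) = n.+1.
Proof.
have c0 : (2 ^+ n * n`!%:R : R)^-1 != 0.
  by rewrite invr_neq0// mulf_neq0 ?expf_neq0 ?pnatr_eq0// -lt0n fact_gt0.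
rewrite /legendre size_scale//.
have sX : size (('X^2 - 1 : {poly R}) ^+ n) = (n.*2).+1.
  have := @size_exp R ('X^2 - 1) n.
  rewrite size_XnsubC// => /(congr1 succn).
  rewrite prednK; last by rewrite lt0n size_poly_eq0 expf_neq0// -size_poly_eq0 size_XnsubC.
  by rewrite mul2n.
apply/anti_leq/andP; split.
  apply/leq_sizeP => j nj; rewrite coef_derivn nth_default ?mul0rn// sX.
  by rewrite -addnn -addnS leq_add2l.
have : (('X^2 - 1 : {poly R}) ^+ n)^`(n)`_n != 0.
  rewrite coef_derivn addnn -mulr_natr mulf_neq0//.
    have := lead_coef_eq0 (('X^2 - 1 : {poly R}) ^+ n).
    by rewrite lead_coefE sX/= => ->; rewrite -size_poly_eq0 sX.
  by rewrite pnatr_eq0 -lt0n ffact_gt0 -addnn leq_addr.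
by apply: contraNltn => ?; apply/eqP; rewrite nth_default.
Qed.

Lemma legendre_at1 (R : realType) (n : nat) : (legendre R n).[1] = 1.
Proof.
have key (q : {poly R}) : ((('X - 1) ^+ n * q)^`(n)).[1] = n`!%:R * q.[1].
  elim: n q => [q|n IH q]; first by rewrite expr0 !mul1r.
  rewrite derivSn derivM deriv_exp derivB derivX derivC subr0 mul1r/=.
  have -> : ('X - 1) ^+ n *+ n.+1 * q + ('X - 1) ^+ n.+1 * q^`() =
      ('X - 1) ^+ n * (q *+ n.+1 + ('X - 1) * q^`()) :> {poly R}.
    by rewrite mulrDr mulrnAl mulrnAr exprSr mulrA.
  rewrite IH hornerD hornerMn hornerM !hornerE subrr mul0r addr0.
  by rewrite factS natrM -mulr_natl; ring.
have fn0 : (2 ^+ n * n`!%:R : R) != 0.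
  by rewrite mulf_neq0 ?expf_neq0 ?pnatr_eq0// -lt0n fact_gt0.
have -> : legendre R n =
    (2 ^+ n * n`!%:R)^-1 *: (('X - 1) ^+ n * ('X + 1) ^+ n)^`(n).
  by rewrite -exprMn /legendre -subr_sqr expr1n.
have Xn1 : (('X + 1 : {poly R}) ^+ n).[1] = 2 ^+ n by rewrite horner_exp !hornerE.
by rewrite hornerZ key Xn1 [X in _ * X]mulrC mulVf.
Qed.

(* Main.v *)
(* With Q_n = D^(n-1) (X^2 - 1)^n / (2^n n!), one has Q_n' = P_n,
   Q_n(-1) = Q_n(1) = 0, (X^2 - 1) Q_n'' = n (n + 1) Q_n and
   (2 n + 1) Q_n = P_(n+1) - P_(n-1).
   By the differential equation, Sonin's function
   Q_n^2 + (1 - x^2) / (n (n + 1)) P_n^2 increases on [-1, 0] and decreases on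
   [0, 1], so |Q_n| is controlled by the values of Q_n and P_n at 0, which are
   central binomial coefficients; Wallis' estimate then gives
   (n + 1/2) |Q_n| <= 2 / sqrt (2 pi n). Since the integral of g P_n is minus
   the Stieltjes integral of Q_n against dg, this is the case m = 0.
   For m >= 1, integrating f P_n = f Q_n' by parts gives
   a_n(f) = a_(n-1)(f') / (2 n - 1) - a_(n+1)(f') / (2 n + 3),
   and the bound follows by induction on m. For an absolutely continuous f
   whose derivative is only known almost everywhere, integration by parts
   amounts to the fact that an absolutely continuous function with zero
   derivative almost everywhere is constant. *)
Require Import Defs.
From HB Require Import structures.
From mathcomp Require Import all_boot all_order all_algebra.
From mathcomp Require Import all_classical all_reals all_analysis.
From mathcomp Require Import ring lra measurable_realfun pi_irrational.

Import Order.TTheory GRing.Theory Num.Theory.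
Import numFieldNormedType.Exports.

Local Open Scope classical_set_scope.
Local Open Scope ring_scope.

(** * Legendre polynomials *)

(** This is [Q_n]. Because [0.-1 = 0], it is the constant 1 at [n = 0] and a primitive of [P_n] only
    for [n > 0]. *)
Definition legendre_primitive (R : realType) (n : nat) : {poly R} :=
  (2 ^+ n * n`!%:R)^-1 *: (('X^2 - 1) ^+ n)^`(n.-1).

Lemma legendre_scale_neq0 (R : realType) (n : nat) :
  (2 ^+ n * n`!%:R : R) != 0.
Proof.
by rewrite mulf_neq0 ?expf_neq0 ?pnatr_eq0// -lt0n fact_gt0.
Qed.

Lemma deriv_legendre_primitive (R : realType) (n : nat) :
  (0 < n)%N -> (legendre_primitive R n)^`() = legendre R n.
Proof.
by case: n => // n _; rewrite /legendre_primitive derivZ -derivnS.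
Qed.

Lemma deriv_pow_X2B1 (R : realType) (n : nat) :
  ((('X^2 - 1 : {poly R}) ^+ n.+1)^`()) = (n.+1)%:R *: ('X *+ 2 * ('X^2 - 1) ^+ n).
Proof.
rewrite deriv_exp derivB derivXn -(polyC1 R) derivC subr0/= expr1.
by rewrite scaler_nat mulrC.
Qed.

Lemma derivn_mulX (R : realType) (p : {poly R}) (k : nat) :
  ('X * p)^`(k) = 'X * p^`(k) + p^`(k.-1) *+ k.
Proof.
elim: k => [|k IH]; first by rewrite !derivn0 mulr0n addr0.
rewrite derivnS IH derivD derivM derivX mul1r derivMn -!derivnS/=.
case: k {IH} => [|k]; first by rewrite mulr0n addr0 mulr1n addrC.
by rewrite /= [X in X + _]addrC -addrA [p^`(_.+1) *+ _ in RHS]mulrS.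
Qed.

(** The power [w = (X^2 - 1)^n] satisfies [(X^2 - 1) w' = 2 n X w]; differentiating this [n] times
    by Leibniz' rule gives the equation for the derivative of order [n - 1] of [w]. *)
Lemma legendre_primitive_ode (R : realType) (n : nat) : (0 < n)%N ->
  ('X^2 - 1) * (legendre_primitive R n)^`()^`() =
  (n * n.+1)%:R *: legendre_primitive R n.
Proof.
case: n => // n _; rewrite deriv_legendre_primitive// /legendre_primitive /legendre.
set c := _^-1; rewrite derivZ -derivnS -scalerAr [RHS]scalerA [_%:R * c]mulrC -[RHS]scalerA.
congr (_ *: _) => /=; set w := ('X^2 - 1 : {poly R}) ^+ n.+1.
have : (('X^2 - 1) * w^`())^`(n.+1) = ((n.+1 *2)%:R *: ('X * w))^`(n.+1).
  congr (_^`(_)); rewrite deriv_pow_X2B1 /w [_ ^+ n.+1]exprS !scaler_nat.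
  by rewrite mulrnAl !mulrnAr -mulrnA mulnC mulrCA.
rewrite mulrBl mul1r derivnB expr2 -mulrA !derivn_mulX derivnZ derivn_mulX/=.
rewrite -!derivSn/=.
(* For [n = 0] the two derivatives differ, but they carry the factor 0. *)
have -> : (w^`(n.-1))^`() *+ n = w^`(n) *+ n by case: (n) => [|k].
rewrite !scaler_nat.
move: 'X (w^`(n)) (w^`(n))^`() ((w^`(n))^`())^`() => X c0 c1 c2 {c w} E.
have {E} : (X * X - 1) * c2 =
    (X * c1 + c0 *+ n.+1) *+ (n.+1 * 2) - (X * c1 *+ (n.+1 * 2) + c0 *+ (n.+1 * n)).
  by rewrite -E; ring.
by move=> ->; ring.
Qed.

(** Two of the derivatives in [P_(n+1)] are carried out on [(X^2 - 1)^(n+1)]. This leaves a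
    combination of [(X^2 - 1)^n] and [(X^2 - 1)^(n-1)], whose derivatives of order [n - 1] are
    multiples of [Q_n] and [P_(n-1)]. *)
Lemma legendre_primitive_rec (R : realType) (n : nat) : (0 < n)%N ->
  (2 * n + 1)%:R *: legendre_primitive R n = legendre R n.+1 - legendre R n.-1.
Proof.
case: n => // n _; rewrite /legendre_primitive /legendre succnK.
rewrite derivSn deriv_pow_X2B1 derivnZ derivSn derivM derivMn derivX.
rewrite deriv_pow_X2B1.
have -> : 1 *+ 2 * ('X^2 - 1) ^+ n.+1 +
       'X *+ 2 * ((n.+1)%:R *: ('X *+ 2 * ('X^2 - 1) ^+ n)) =
   (2 * (2 * n.+1 + 1))%:R *: ('X^2 - 1 : {poly R}) ^+ n.+1 +
   (4 * n.+1)%:R *: ('X^2 - 1) ^+ n.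
  rewrite !scaler_nat exprS; ring.
rewrite derivnD !derivnZ !scalerDr !scalerA.
have n0 : (2 ^+ n * n`!%:R : R) != 0 := legendre_scale_neq0 R n.
move: n0; rewrite mulf_eq0 negb_or => /andP[n0 f0].
rewrite -addrA -scalerBl.
rewrite [X in _ = _ + X *: _](_ : _ = 0) ?scale0r ?addr0; last first.
  rewrite !factS !exprS !natrM; field.
  by rewrite n0 f0/= nat1r -natrD !pnatr_eq0.
apply: (congr1 (fun z : R => z *: _)).
rewrite !factS !exprS !natrM; field.
by rewrite n0 f0/= nat1r -natrD !pnatr_eq0.
Qed.

(** The factor [X^2 - 1] kills the left side of the differential equation, and [n (n + 1)] is
    nonzero. *)
Lemma legendre_primitive_at_pm1 (R : realType) (n : nat) (x : R) :
  (0 < n)%N -> x ^+ 2 = 1 -> (legendre_primitive R n).[x] = 0.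
Proof.
move=> n0 x2; have := congr1 (horner^~ x) (legendre_primitive_ode R n n0).
rewrite /= hornerM hornerZ hornerD hornerXn hornerN hornerC x2 subrr mul0r.
move=> /esym/eqP; rewrite mulf_eq0 pnatr_eq0 muln_eq0 -!leqn0 leqNgt n0/=.
by move=> /eqP.
Qed.

(** Needed for the values of [P_n] and [Q_n] at 0, which are multiples of one coefficient of this
    power. *)
Lemma coef_pow_X2B1_even (R : realType) (n k : nat) : (k <= n)%N ->
  (('X^2 - 1 : {poly R}) ^+ n)`_(k.*2) = (-1) ^+ (n - k) * 'C(n, k)%:R.
Proof.
elim: n k => [|n IH] [|k] //.
- by rewrite expr0 coef1 eqxx subn0 expr0 mulr1.
- move=> _; rewrite exprS mulrBl mul1r coefB coefXnM/= IH// !subn0 !bin0 exprS.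
  ring.
rewrite ltnS => kn; rewrite exprS mulrBl mul1r coefB coefXnM/=.
rewrite [X in _`_X - _](_ : _ = k.*2)%N; last by rewrite doubleS subn2.
rewrite IH// subSS binS natrD.
move: kn; rewrite leq_eqVlt => /predU1P[->|kn].
  rewrite [n.+1.*2]doubleS nth_default; last first.
    rewrite (@leq_trans (n.*2).+1)//.
    have := @size_exp R ('X^2 - 1) n.
    rewrite size_XnsubC// => /(congr1 succn).
    rewrite prednK;
      last by rewrite lt0n size_poly_eq0 expf_neq0// -size_poly_eq0 size_XnsubC.
    by rewrite mul2n => ->.
  by rewrite (@bin_small n n.+1)//; ring.
rewrite IH//.
by rewrite -(subnSK kn) exprS; ring.
Qed.

Lemma coef_pow_X2B1_odd (R : realType) (n k : nat) :
  (('X^2 - 1 : {poly R}) ^+ n)`_(k.*2.+1) = 0.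
Proof.
elim: n k => [|n IH] [|k]; rewrite ?expr0 ?coef1//.
  by rewrite exprS mulrBl mul1r coefB coefXnM/= IH subr0.
by rewrite exprS mulrBl mul1r coefB coefXnM/= !IH subr0.
Qed.

(** * Wallis' estimate *)

Lemma ge0_is_derive_le (R : realType) (f df : R -> R) (a b : R) : a <= b ->
  (forall x : R, is_derive x 1 f (df x)) ->
  (forall x, a <= x <= b -> 0 <= df x) -> f a <= f b.
Proof.
move=> ab fdf df0.

have fx x : x \in `]a, b[ -> is_derive x 1 f (df x) by move=> _; exact: fdf.
have [|c cab fE] := MVT_segment ab fx.
  apply: continuous_subspaceT => x; apply: differentiable_continuous.
  by apply/derivable1_diffP; have [] := fdf x.
by rewrite -subr_ge0 fE mulr_ge0 ?subr_ge0// df0.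
Qed.

(** This number is [|P_(2k)(0)|], and also [2 / pi] times the integral of [sin^(2k)] over
    [[0, pi / 2]]; the second reading gives its size. *)
Definition wallis (R : realType) (k : nat) : R := 'C(k.*2, k)%:R / 4 ^+ k.

Lemma wallis_gt0 (R : realType) (k : nat) : 0 < wallis R k.
Proof.
rewrite divr_gt0 ?exprn_gt0// ltr0n bin_gt0 -addnn.
exact: leq_addr.
Qed.

Lemma wallisS (R : realType) (k : nat) :
  (2 * k%:R + 2) * wallis R k.+1 = (2 * k%:R + 1) * wallis R k.
Proof.
have E : ('C(k.+1.*2, k.+1) * k.+1 = 2 * (k.*2.+1) * 'C(k.*2, k))%N.
  have C1 : (k.+1 * 'C(k.*2.+1, k.+1) = k.*2.+1 * 'C(k.*2, k))%N.
    by rewrite mul_bin_diag.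
  have C2 : ('C(k.*2.+1, k.+1) = 'C(k.*2.+1, k))%N.
    rewrite -bin_sub; last by rewrite ltnS -addnn leq_addr.
    by congr 'C(_, _); rewrite -addnn subSS addnK.
  by rewrite doubleS binS -C2 addnn -mul2n -mulnA [(_ * k.+1)%N]mulnC C1 mulnA.
have {}E : 'C(k.+1.*2, k.+1)%:R * (k%:R + 1) = 2 * (2 * k%:R + 1) * 'C(k.*2, k)%:R :> R.
  by rewrite natr1 -natrM E !natrM -(natr1 k.*2) -(muln2 k) natrM; ring.
rewrite /wallis exprS invfM.
have : (4 ^+ k : R) != 0 by rewrite expf_neq0.
have k0 : k%:R + 1 != 0 :> R by rewrite natr1 pnatr_eq0.
move: E; move: 'C(_, _)%:R => c; move: 'C(_, _)%:R => d; move: (4 ^+ k) => t E t0.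
have -> : c = 2 * (2 * k%:R + 1) * d / (k%:R + 1).
  by rewrite -E mulfK.
by field; rewrite t0.
Qed.

(** The reduction formula for the primitive of [sin^n] vanishing at 0. With explicit primitives,
    Wallis' integrals need derivatives only. *)
Fixpoint sinpow_primitive (R : realType) (n : nat) (x : R) : R :=
  match n with
  | 0 => x
  | n'.+1 => match n' with
    | 0 => 1 - cos x
    | k.+1 => (n'%:R * sinpow_primitive R k x - sin x ^+ n' * cos x) / n%:R
    end
  end.

Lemma nat_ind2 (P : nat -> Prop) :
  P 0%N -> P 1%N -> (forall n, P n -> P n.+2) -> forall n, P n.
Proof.
move=> P0 P1 PS n; suff [] : P n /\ P n.+1 by [].
by elim: n => // n [Pn Pn1]; split => //; exact: PS.
Qed.

Lemma is_derive_sinpow_primitive (R : realType) (n : nat) (x : R) :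
  is_derive x 1 (sinpow_primitive R n) (sin x ^+ n).
Proof.
elim/nat_ind2: n => [||n IH].
- by rewrite expr0; exact: is_derive_id.
- rewrite expr1 /=; apply: trigger_derive.
  by rewrite add0r mul1r opprK.
rewrite (_ : sinpow_primitive R n.+2 = (n.+2%:R)^-1 *:
   (n.+1%:R *: sinpow_primitive R n - (sin ^+ n.+1) * cos)); last first.
  by apply/funext => y /=; rewrite mulrC !fctE.
apply: trigger_derive.
rewrite /GRing.scale/= exprfctE.
have n2 : n.+2%:R != 0 :> R by rewrite pnatr_eq0.
rewrite (_ : n.+1%:R = n.+2%:R - 1); last by rewrite -(natr1 n.+1) addrK.
have c2 : cos x * cos x = 1 - sin x * sin x.
  by rewrite -(cos2Dsin2 x) !expr2 addrK.
rewrite [sin x ^+ n.+2]exprS [sin x ^+ n.+1]exprS; move: n.+2%:R n2 (sin x ^+ n) => t t0 S.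
transitivity (t^-1 * ((t - 1) * S * (1 - cos x * cos x) + sin x * sin x * S)).
  by ring.
by rewrite c2; move: (sin x) => s; field.
Qed.

Lemma sinpow_primitive0 (R : realType) (n : nat) : sinpow_primitive R n 0 = 0.
Proof.
elim/nat_ind2: n => [||n IH] /=; rewrite ?cos0 ?subrr//.
by rewrite IH sin0 mulr0 exprS !mul0r subr0 mul0r.
Qed.

Lemma sinpow_primitive_pihalfSS (R : realType) (n : nat) :
  sinpow_primitive R n.+2 (pi / 2) =
  n.+1%:R / n.+2%:R * sinpow_primitive R n (pi / 2).
Proof. by rewrite /= cos_pihalf mulr0 subr0 mulrAC. Qed.

(** The product of equations serves as a single multirule for [rewrite]. *)
Lemma natr_doubleS (R : realType) (k : nat) :
  (k.*2.+1%:R = 2 * k%:R + 1 :> R) * (k.*2.+2%:R = 2 * k%:R + 2 :> R) *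
  (k.*2.+3%:R = 2 * k%:R + 3 :> R).
Proof.
have d : k.*2%:R = 2 * k%:R :> R by rewrite -mul2n natrM.
by split; [split|]; rewrite -d ?natr1// -natrD ?addn2 ?addn3.
Qed.

Lemma sinpow_primitive_pihalf_even (R : realType) (k : nat) :
  sinpow_primitive R k.*2 (pi / 2) = wallis R k * (pi / 2).
Proof.
elim: k => [|k IH]; first by rewrite /wallis bin0 expr0 divr1 mul1r.
rewrite doubleS sinpow_primitive_pihalfSS IH [LHS]mulrA; congr (_ * _).
have k0 : 2 * k%:R + 2 != 0 :> R.
  by rewrite gt_eqF// ltr_wpDl// mulr_ge0.
apply: (mulfI k0); by rewrite wallisS !(natr_doubleS R k); field.
Qed.

(** From [k] to [k + 1], [wallis] gains the factor [(2k + 1) / (2k + 2)] and the integral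
    [(2k + 2) / (2k + 3)], so the product does not change. *)
Lemma sinpow_primitive_pihalf_odd (R : realType) (k : nat) :
  (2 * k%:R + 1) * wallis R k * sinpow_primitive R k.*2.+1 (pi / 2) = 1.
Proof.
elim: k => [|k IH].
  by rewrite /wallis bin0 expr0 /= cos_pihalf; field.
rewrite doubleS sinpow_primitive_pihalfSS.
have k2 : 2 * k%:R + 2 != 0 :> R by rewrite gt_eqF// ltr_wpDl// mulr_ge0.
have k3 : 2 * k%:R + 3 != 0 :> R by rewrite gt_eqF// ltr_wpDl// mulr_ge0.
rewrite -[RHS]IH -[in RHS]wallisS !(natr_doubleS R k) -(natr1 k).
by move: (wallis _ _) (sinpow_primitive _ _ _) => w s; field.
Qed.

(** Since [0 <= sin <= 1] on [[0, pi / 2]], the difference of the two primitives increases from its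
    value 0 at 0. *)
Lemma sinpow_primitive_pihalf_nincr (R : realType) (n : nat) :
  sinpow_primitive R n.+1 (pi / 2) <= sinpow_primitive R n (pi / 2).
Proof.
have := @ge0_is_derive_le R
  (sinpow_primitive R n - sinpow_primitive R n.+1)
  (fun x => sin x ^+ n - sin x ^+ n.+1) 0 (pi / 2).
rewrite !fctE !sinpow_primitive0 subrr subr_ge0; apply.
- by rewrite divr_ge0// pi_ge0.
- by move=> x; apply: is_deriveB; exact: is_derive_sinpow_primitive.
move=> x /andP[x0 xpi].
have s0 : 0 <= sin x.
  by rewrite sin_ge0_pi// x0 (le_trans xpi)// ler_pdivrMr// ler_peMr// ?pi_ge0// ler1n.
by rewrite exprS -{1}(mul1r (_ ^+ n)) -mulrBl mulr_ge0 ?exprn_ge0 ?subr_ge0 ?sin_le1.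
Qed.

(** Compares the integrals of [sin^(2k+2)] and [sin^(2k+1)]. The estimate is sharp only as [k] tends
    to infinity; [wallis_le] transfers its limit to every [k]. *)
Lemma wallis_weak (R : realType) (k : nat) :
  wallis R k ^+ 2 * (2 * k%:R + 1) ^+ 2 * pi <= 4 * (k%:R + 1).
Proof.
have := sinpow_primitive_pihalf_nincr R k.*2.+1.
rewrite -doubleS sinpow_primitive_pihalf_even => H.
have k1 : 0 < 2 * k%:R + 1 :> R by rewrite ltr_wpDl// mulr_ge0.
have w0 := wallis_gt0 R k.
have : (2 * k%:R + 1) * wallis R k * (wallis R k.+1 * (pi / 2)) <= 1.
  rewrite -[leRHS](sinpow_primitive_pihalf_odd R k) ler_pM2l//.
  by rewrite mulr_gt0.
have -> : wallis R k ^+ 2 * (2 * k%:R + 1) ^+ 2 * pi =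
   (2 * k%:R + 1) * wallis R k * pi * ((2 * k%:R + 1) * wallis R k) by ring.
rewrite -wallisS; set w' := wallis R k.+1 => H1.
have -> : (2 * k%:R + 2) * w' * pi * ((2 * k%:R + 2) * w') =
  4 * (k%:R + 1) * ((2 * k%:R + 2) * w' * (w' * (pi / 2))) by field.
rewrite -[leRHS]mulr1 ler_pM2l//.
Qed.

(** By [wallisS] one step reduces to [(4m + 1) (2m + 2)^2 <= (4m + 5) (2m + 1)^2], whose sides
    differ by 1. *)
Lemma wallis_sqr_ndecr (R : realType) (j k : nat) : (k <= j)%N ->
  (4 * k%:R + 1) * wallis R k ^+ 2 <= (4 * j%:R + 1) * wallis R j ^+ 2.
Proof.
move=> kj; rewrite -(subnK kj); elim: (j - k)%N => // i IH.
apply: (le_trans IH); rewrite addSn.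
set m := (i + k)%N.
have m0 : 0 <= m%:R :> R by [].
have m1 : 0 < (2 * m%:R + 2) ^+ 2 :> R by rewrite exprn_gt0// ltr_wpDl// mulr_ge0.
have E : (2 * m%:R + 2) ^+ 2 * wallis R m.+1 ^+ 2 = (2 * m%:R + 1) ^+ 2 * wallis R m ^+ 2.
  by rewrite -!exprMn wallisS.
rewrite -(ler_pM2l m1) [leRHS]mulrCA E mulrA [leRHS]mulrA ler_wpM2r ?sqr_ge0//.
by rewrite -natr1; nra.
Qed.

(* [(4 k + 1) C(2k,k)^2 / 16^k] increases to its limit [4 / pi]. *)
Lemma wallis_le (R : realType) (k : nat) :
  (4 * k%:R + 1) * wallis R k ^+ 2 * pi <= 4.
Proof.
rewrite leNgt; apply/negP => lt4.
set u := (_ * _) in lt4.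
have e0 : 0 < u - 4 by rewrite subr_gt0.
(* By monotonicity [wallis_weak] at [j = N + k] forces [(u - 4) (2j + 1)^2 <= 4 j], which fails once
   [j (u - 4) > 4]. *)
have [N HN] : exists N : nat, 4 / (u - 4) < N%:R.
  exists (Num.bound (4 / (u - 4))); apply: archi_boundP.
  by rewrite divr_ge0// ltW.
set j := (N + k)%N.
have uj : u <= (4 * j%:R + 1) * (wallis R j ^+ 2 * pi).
  by rewrite mulrA ler_pM2r ?pi_gt0// wallis_sqr_ndecr// leq_addl.
have jN : 4 < j%:R * (u - 4).
  rewrite -ltr_pdivrMr//; apply: (lt_le_trans HN).
  by rewrite ler_nat leq_addr.
have W : wallis R j ^+ 2 * pi * (2 * j%:R + 1) ^+ 2 <= 4 * (j%:R + 1).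
  by rewrite mulrAC wallis_weak.
have j0 : 0 <= j%:R :> R by [].
move: uj W; move: (wallis R j ^+ 2 * pi) => X; move: j%:R j0 jN => t t0 tu uX XW.
have : u * (2 * t + 1) ^+ 2 <= (4 * t + 1) * (4 * (t + 1)).
  apply: (@le_trans _ _ ((4 * t + 1) * X * (2 * t + 1) ^+ 2)).
    by rewrite ler_wpM2r// sqr_ge0.
  by rewrite -mulrA ler_wpM2l// addr_ge0// mulr_ge0.
nra.
Qed.

(** * A uniform bound for the primitives of Legendre polynomials *)

(** Sonin's function exceeds [p^2] by a multiple of [1 - x^2 >= 0], and its maximum on [[-1, 1]],
    reached at 0, is the right-hand side. *)
Lemma sonin_le (R : realType) (p : {poly R}) (N x : R) : 0 < N ->
  ('X^2 - 1) * p^`()^`() = N *: p -> -1 <= x <= 1 ->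
  p.[x] ^+ 2 <= p.[0] ^+ 2 + N^-1 * p^`().[0] ^+ 2.
Proof.
move=> N0 ode /andP[x1 x2].
(* G is Sonin's function; the equation makes G' a multiple of - x p'^2. *)
pose G : {poly R} := p ^+ 2 + N^-1 *: ((1 - 'X^2) * p^`() ^+ 2).
have dsqr (q : {poly R}) : (q ^+ 2)^`() = q * q^`() *+ 2.
  by rewrite expr2 derivM; ring.
have dG : G^`() = - (2 * N^-1) *: ('X * p^`() ^+ 2).
  have -> : G^`() = (p + N^-1 *: ((1 - 'X^2) * p^`()^`())) * p^`() *+ 2
     - (2 * N^-1) *: ('X * p^`() ^+ 2).
    rewrite /G derivD derivZ [((1 - 'X^2) * _)^`()]derivM !dsqr derivB dsqr derivX.
    rewrite -(polyC1 R) derivC sub0r mulr1 -!mul_polyC polyCM.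
    move: N^-1%:P p^`()^`() p^`() => a b c; ring.
  have -> : (1 - 'X^2) * p^`()^`() = - (N *: p) by rewrite -ode; ring.
  by rewrite scalerN scalerA mulVf ?gt_eqF// scale1r subrr mul0r mul0rn sub0r scaleNr.
have GE y : G.[y] = p.[y] ^+ 2 + N^-1 * ((1 - y ^+ 2) * p^`().[y] ^+ 2).
  by rewrite /G !hornerE/=; ring.
have G0 : G.[0] = p.[0] ^+ 2 + N^-1 * p^`().[0] ^+ 2 by rewrite GE; ring.
have Gx : p.[x] ^+ 2 <= G.[x].
  rewrite GE lerDl mulr_ge0 ?invr_ge0 ?(ltW N0)// mulr_ge0 ?sqr_ge0//; nra.
rewrite -G0; apply: (le_trans Gx).
have Gd y : G^`().[y] = - (2 * N^-1 * p^`().[y] ^+ 2) * y.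
  by rewrite dG !hornerE/=; ring.
have c0 y : 0 <= 2 * N^-1 * p^`().[y] ^+ 2.
  by rewrite mulr_ge0 ?sqr_ge0// mulr_ge0 ?invr_ge0 ?(ltW N0).
have [x0|x0] := leP 0 x.
  rewrite -lerN2.
  apply: (@ge0_is_derive_le R (- horner G) (fun y => - G^`().[y]) 0 x) => //.
  move=> y /andP[y0 _]; rewrite Gd mulNr opprK mulr_ge0//.
apply: (@ge0_is_derive_le R (horner G) (horner G^`()) x 0) => [|y /andP[_ y0]].
  exact: ltW.
by rewrite Gd mulNr oppr_ge0 mulr_ge0_le0.
Qed.

(** The derivative of order [2k] of [(X^2 - 1)^(2k+1)] at 0 is [(2k)!] times the coefficient
    [C(2k + 1, k)], up to sign; that binomial is then expressed through [C(2k, k)]. *)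
Lemma legendre_primitive_at0_odd (R : realType) (k : nat) :
  `|(legendre_primitive R k.*2.+1).[0]| = wallis R k / (2 * (k%:R + 1)).
Proof.
have kn : (k <= k.*2.+1)%N by rewrite -addnn -addnS leq_addr.
rewrite /legendre_primitive hornerZ horner_coef0 coef_derivn addn0 ffactnn/=.
rewrite coef_pow_X2B1_even// normrM normfV normrMn -[`|_ * _| *+ _]mulr_natr
  !normrM !normrX normrN1.
rewrite expr1n mul1r !normr_nat.
have C1 : (k.+1 * 'C(k.*2.+1, k) = k.*2.+1 * 'C(k.*2, k))%N.
  by rewrite -(bin_sub kn) (_ : _ - k = k.+1)%N -?mul_bin_diag// -addnn -addnS addKn.
have {}C1 : (k%:R + 1) * 'C(k.*2.+1, k)%:R = (2 * k%:R + 1) * 'C(k.*2, k)%:R :> R.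
  by rewrite natr1 -natrM C1 natrM (natr_doubleS R k).
have k1 : k%:R + 1 != 0 :> R by rewrite natr1 pnatr_eq0.
have k2 : 2 * k%:R + 1 != 0 :> R by rewrite -(natr_doubleS R k) pnatr_eq0.
have -> : 'C(k.*2.+1, k)%:R = (2 * k%:R + 1) * 'C(k.*2, k)%:R / (k%:R + 1) :> R.
  by rewrite -C1 mulrAC mulfV// mul1r.
have f0 : (k.*2)`!%:R != 0 :> R by rewrite pnatr_eq0 -lt0n fact_gt0.
have t0 : 2 ^+ k != 0 :> R by rewrite expf_neq0.
rewrite /wallis factS natrM (natr_doubleS R k) exprS -mul2n exprM (_ : 2 ^+ 2 =
  4 :> R); last by rewrite -natrX.
have f4 : 4 ^+ k != 0 :> R by rewrite expf_neq0.
rewrite mul2n; move: (k.*2)`!%:R f0 'C(_, _)%:R => f f0 c.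
by field; rewrite f4 f0 k1 k2.
Qed.

Lemma legendre_primitive_at0_even (R : realType) (k : nat) : (0 < k)%N ->
  (legendre_primitive R k.*2).[0] = 0.
Proof.
case: k => // k _; rewrite doubleS /legendre_primitive hornerZ horner_coef0.
by rewrite coef_derivn addn0 coef_pow_X2B1_odd mul0rn mulr0.
Qed.

Lemma legendre_at0_odd (R : realType) (k : nat) : (legendre R k.*2.+1).[0] = 0.
Proof.
rewrite /legendre hornerZ horner_coef0.
by rewrite coef_derivn addn0 coef_pow_X2B1_odd mul0rn mulr0.
Qed.

Lemma legendre_at0_even (R : realType) (k : nat) :
  `|(legendre R k.*2).[0]| = wallis R k.
Proof.
rewrite /legendre hornerZ horner_coef0 coef_derivn addn0 ffactnn.
have kn : (k <= k.*2)%N by rewrite -addnn leq_addr.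
rewrite coef_pow_X2B1_even// normrM normfV normrMn -[`|_ * _| *+ _]mulr_natr
  !normrM !normrX normrN1.
rewrite expr1n mul1r !normr_nat.
have f0 : (k.*2)`!%:R != 0 :> R by rewrite pnatr_eq0 -lt0n fact_gt0.
have f4 : 4 ^+ k != 0 :> R by rewrite expf_neq0.
rewrite /wallis -mul2n exprM (_ : 2 ^+ 2 = 4 :> R); last by rewrite -natrX.
rewrite mul2n; move: (k.*2)`!%:R f0 'C(_, _)%:R => f f0 c.
by field; rewrite f4 f0.
Qed.

(** By parity one of [Q_n(0)] and [P_n(0)] vanishes, and the other one is estimated by
    [wallis_le]. *)
Lemma legendre_primitive_le (R : realType) (n : nat) (x : R) :
  (0 < n)%N -> -1 <= x <= 1 ->
  (n%:R + 2^-1) * `|(legendre_primitive R n).[x]| <=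
    2 / Num.sqrt (2 * pi * n%:R).
Proof.
move=> n0 x11; set Q := legendre_primitive R n.
have N0 : 0 < (n * n.+1)%:R :> R by rewrite ltr0n muln_gt0 n0.
have := sonin_le _ _ _ _ N0 (legendre_primitive_ode R n n0) x11.
rewrite deriv_legendre_primitive// -/Q => S.
have pn0 : 0 < pi * n%:R :> R by rewrite mulr_gt0 ?pi_gt0 ?ltr0n.
have r0 : 0 <= 2 / Num.sqrt (2 * pi * n%:R) :> R by rewrite divr_ge0// sqrtr_ge0.
have h0 : 0 <= n%:R + 2^-1 :> R by rewrite addr_ge0.
rewrite -(@ler_pXn2r _ 2)// ?nnegrE ?mulr_ge0//.
rewrite !exprMn exprVn sqr_sqrtr; last by rewrite -mulrA mulr_ge0// ltW.
rewrite -normrX ger0_norm ?sqr_ge0//.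
(* The square of [2 / sqrt (2 pi n)] is [2 / (pi n)]; its denominator is moved to the left. *)
suff K : (n%:R + 2^-1) ^+ 2 * (Q.[0] ^+ 2 + (n * n.+1)%:R^-1 * (legendre R n).[0] ^+ 2)
   * (pi * n%:R) <= 2.
  apply: (@le_trans _ _ (2 / (pi * n%:R))).
    by rewrite ler_pdivlMr// (le_trans _ K)// ler_pM2r// ler_wpM2l ?sqr_ge0.
  rewrite le_eqVlt; apply/orP; left; apply/eqP.
  move: (pi_gt0 R) n0; rewrite -(ltr0n R); move: (pi : R) n%:R => P N P0 NR0.
  by field; rewrite !gt_eqF.
have sqE (y : R) : y ^+ 2 = `|y| ^+ 2 by rewrite real_normK ?num_real.
move: n0; rewrite {r0 h0 pn0 S N0 x11}/Q -(odd_double_half n); case: (odd n) => /= [_|].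
  rewrite add1n legendre_at0_odd [(legendre_primitive _ _).[0] ^+ 2]sqE
    legendre_primitive_at0_odd.
  rewrite (natr_doubleS R n./2) expr0n/= mulr0 addr0.
  move: n./2 => k.
  have k0 : 0 <= k%:R :> R by [].
  have -> : (2 * k%:R + 1 + 2^-1) ^+ 2 * (wallis R k / (2 * (k%:R + 1))) ^+ 2
     * (pi * (2 * k%:R + 1)) =
     (4 * k%:R + 3) ^+ 2 * (2 * k%:R + 1) * (wallis R k ^+ 2 * pi) / (16 * (k%:R + 1) ^+ 2).
    by move: (pi : R) => P; field; rewrite natr1 pnatr_eq0.
  rewrite ler_pdivrMr; last by rewrite mulr_gt0// exprn_gt0// natr1 ltr0n.
  (* For [k = 0] the claim amounts to [9 pi <= 32]. There [wallis_le] at 0 gives only [pi <= 4],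
     while at 1 it gives [pi <= 16 / 5]. *)
  case: k k0 => [_|k k0].
    have := wallis_le R 1; rewrite /wallis (_ : 'C(1.*2, 1) = 2)%N// bin0 !expr0 expr1.
    by lra.
  have := wallis_le R k.+1; rewrite -mulrA.
  have := @sqr_ge0 R (wallis R k.+1); have := pi_ge0 R.
  have : 1 <= k.+1%:R :> R by rewrite ler1n.
  move: (wallis R k.+1 ^+ 2) k.+1%:R => w t t1 pi0 w0 W.
  have wp0 : 0 <= w * pi by rewrite mulr_ge0.
  move: (w * pi) wp0 W => X X0 W.
  suff : (4 * t + 1) * ((4 * t + 3) ^+ 2 * (2 * t + 1) * X) <= (4 * t + 1) * (2
    * (16 * (t + 1) ^+ 2)).
    by rewrite ler_pM2l//; lra.
  rewrite mulrCA; apply: (@le_trans _ _ ((4 * t + 3) ^+ 2 * (2 * t + 1) * 4)).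
    by rewrite ler_wpM2l// mulr_ge0 ?sqr_ge0//; lra.
  nra.
rewrite add0n double_gt0 => k0.
rewrite legendre_primitive_at0_even// [(legendre _ _).[0] ^+ 2]sqE legendre_at0_even.
move: n./2 k0 => k k0.
have k1 : 0 < k%:R :> R by rewrite ltr0n.
have k2 : 0 < 2 * k%:R + 1 :> R by rewrite addr_gt0// mulr_gt0.
rewrite natrM (natr_doubleS R k) -mul2n natrM expr0n/= add0r.
have -> : (2 * k%:R + 2^-1) ^+ 2 * ((2 * k%:R * (2 * k%:R + 1))^-1 * wallis R k ^+ 2) *
    (pi * (2 * k%:R)) =
    (4 * k%:R + 1) * ((4 * k%:R + 1) * wallis R k ^+ 2 * pi) / (4 * (2 * k%:R + 1)).
  by move: (pi : R) => P; field; rewrite !gt_eqF.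
rewrite ler_pdivrMr; last by rewrite mulr_gt0.
apply: (@le_trans _ _ ((4 * k%:R + 1) * 4)); last by lra.
by rewrite ler_wpM2l ?wallis_le//; lra.
Qed.

(** * Absolutely continuous functions *)

(** Lists ordered from right to left are what a scan of [[a, b]] from the left builds by consing. *)
Lemma abs_continuous_seq (R : realType) (a b : R) (f : R -> R) (e : R) :
  abs_continuous a b f -> 0 < e -> exists2 d : R, 0 < d &
    forall l : seq (R * R),
      all (fun p => [&& a <= p.1, p.1 <= p.2 & p.2 <= b]) l ->
      pairwise (fun p q => q.2 <= p.1) l ->
      \sum_(p <- l) (p.2 - p.1) < d ->
      \sum_(p <- l) `|f p.2 - f p.1| < e.
Proof.
move=> fac e0; have [d d0 dP] := fac e e0; exists d => // l lab lp ld.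
pose s (i : 'I_(size l)) := (nth (0, 0) l i).1.
pose t (i : 'I_(size l)) := (nth (0, 0) l i).2.
have := dP (size l) s t; rewrite (big_nth (0, 0)) big_mkord; apply.
- by move=> i; have /and3P[] := all_nthP (0, 0) lab i (ltn_ord i).
- have tr (i j : 'I_(size l)) : (i < j)%N ->
      `]s i, t i[%classic `&` `]s j, t j[%classic = set0.
    move=> ij; have /(_ i j) := pairwiseP (0, 0) lp.
    rewrite !inE !ltn_ord => /(_ isT isT ij) ts.
    apply/seteqP; split => // x [] /=; rewrite !in_itv/= => /andP[sx _] /andP[_ xt].
    by have := lt_trans (lt_le_trans xt ts) sx; rewrite ltxx.
  move=> i j _ _ [x xij]; apply/eqP; rewrite -val_eqE/=; case: ltngtP => //= ij.
    by have := tr _ _ ij; move=> /seteqP[/(_ x xij)].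
  by have := tr _ _ ij; rewrite setIC => /seteqP[/(_ x xij)].
- by move: ld; rewrite (big_nth (0, 0)) big_mkord.
Qed.

(** Meant for [h = f q - K] with [q] a polynomial and [K] Lipschitz. *)
Lemma abs_continuous_dom (R : realType) (a b A B : R) (f h : R -> R) :
  0 <= A -> 0 <= B -> abs_continuous a b f ->
  (forall s t, a <= s -> s <= t -> t <= b ->
     `|h t - h s| <= A * `|f t - f s| + B * (t - s)) ->
  abs_continuous a b h.
Proof.
move=> A0 B0 fac hf e e0.
(* [A] and [B] may be 0, so [A + 1] and [B + 1] are used as denominators. *)
have A1 : 0 < A + 1 by rewrite ltr_wpDl.
have B1 : 0 < B + 1 by rewrite ltr_wpDl.
have e1 : 0 < e / 2 / (A + 1) by rewrite !divr_gt0.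
have e2 : 0 < e / 2 / (B + 1) by rewrite !divr_gt0.
have [d d0 dP] := fac _ e1.
exists (Num.min d (e / 2 / (B + 1))); first by rewrite lt_min d0.
move=> n s t st tr; rewrite lt_min => /andP[sd se].
have := dP n s t st tr sd; rewrite ltr_pdivlMr// => F.
move: se; rewrite ltr_pdivlMr// => S.
have Sge : 0 <= \sum_(i < n) (t i - s i).
  by rewrite sumr_ge0// => i _; rewrite subr_ge0; have [_ []] := st i.
have Fge : 0 <= \sum_(i < n) `|f (t i) - f (s i)| by rewrite sumr_ge0.
apply: (@le_lt_trans _ _ (\sum_(i < n) (A * `|f (t i) - f (s i)| + B * (t i - s i)))).
  by apply: ler_sum => i _; apply: hf; have [? []] := st i.
rewrite big_split/= -!mulr_sumr; nra.
Qed.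

Lemma abs_continuous_within_continuous (R : realType) (a b : R) (f : R -> R) :
  abs_continuous a b f -> {within `[a, b], continuous f}.
Proof.
move=> fac; apply/subspace_continuousP => x /=; rewrite in_itv/= => /andP[ax xb].
apply/cvgrPdist_lt => e e0; have [d d0 dP] := abs_continuous_seq _ _ _ _ _ fac e0.
have K u v : a <= u -> u <= v -> v <= b -> v - u < d -> `|f v - f u| < e.
  move=> au uv vb uvd; have := dP [:: (u, v)].
  by rewrite /= au uv vb !big_seq1; apply.
rewrite near_withinE; near=> y => /=; rewrite in_itv/= => /andP[ay yb].
have xyd : `|x - y| < d by near: y; exact: (@cvgr_dist_lt _ _ _ (nbhs x) _ id).
have [xy|yx] := leP x y.
  by rewrite distrC K//; move: xyd; rewrite distrC ger0_norm ?subr_ge0.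
rewrite K// ?(ltW yx)//; move: xyd; rewrite ger0_norm ?subr_ge0//.
exact: ltW.
Unshelve. all: by end_near. Qed.

Lemma within_continuous_bounded (R : realType) (a b : R) (f : R -> R) :
  a <= b -> {within `[a, b], continuous f} ->
  exists2 M, 0 <= M & forall x, x \in `[a, b] -> `|f x| <= M.
Proof.
move=> ab fc.
have [|c cab cP] := @EVT_max R (fun x => `|f x|) a b ab.
  by move=> x; apply: continuous_comp; [exact: fc|exact: norm_continuous].
by exists `|f c|.
Qed.

(** * Functions with zero derivative almost everywhere *)

Section zero_derivative.
Context {R : realType}.
Notation mu := (@lebesgue_measure R).
Variables (a b : R) (h : R -> R) (U : set R) (e : R).
Hypotheses (mU : measurable U) (e0 : 0 <= e).

(* Part of the variation of h over [a, x] is charged to intervals inside U,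
   listed from right to left; outside of them h grows at a rate at most e. *)
Let charged (x : R) := exists l : seq (R * R),
  [/\ all (fun p => [&& a <= p.1, p.1 <= p.2 & p.2 <= x]) l,
      pairwise (fun p q => q.2 <= p.1) l,
      ((\sum_(p <- l) (p.2 - p.1))%:E <= mu (U `&` `]a, x[))%E &
      `|h x - h a| <= e * (x - a) + \sum_(p <- l) `|h p.2 - h p.1| ].

(** The list is kept; the new variation goes into the term [e (y - a)]. *)
Let charged_rate (x y : R) : a <= x -> x <= y ->
  `|h y - h x| <= e * (y - x) -> charged x -> charged y.
Proof.
move=> ax xy hxy [l [l1 l2 l3 l4]]; exists l; split => //.
- by apply: sub_all l1 => p /and3P[-> -> /le_trans]; apply.
- apply: (le_trans l3); apply: le_measure; rewrite ?inE; [| |].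
  + exact: measurableI.
  + exact: measurableI.
  + by apply: setIS; apply: subset_itvl; rewrite bnd_simp.
- have := ler_distD (h x) (h y) (h a); lra.
Qed.

(** The pair [(x, y)] joins the list, its length being paid for by the measure of []x, y[], a part
    of [U]. *)
Let charged_open (x y : R) : a <= x -> x < y ->
  `]x, y[ `<=` U -> charged x -> charged y.
Proof.
move=> ax xy xyU [l [l1 l2 l3 l4]]; exists ((x, y) :: l); split => //=.
- rewrite ax (ltW xy) lexx/=.
  by apply: sub_all l1 => p /and3P[-> -> /le_trans]; apply; exact: ltW.
- by rewrite l2 andbT; apply: sub_all l1 => p /and3P[].
- rewrite big_cons/= EFinD.
  apply: (@le_trans _ _ (mu `]x, y[ + mu (U `&` `]a, x[))%E).
    by apply: leeD => //; rewrite lebesgue_measure_itv/= lte_fin xy EFinB.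
  rewrite -measureU//=.
  + apply: le_measure; rewrite ?inE//.
    * by apply: measurableU => //; exact: measurableI.
    * exact: measurableI.
    * move=> z [zxy|[Uz]] /=.
        split; first exact: xyU.
        by move: zxy; rewrite /= !in_itv/= => /andP[xz ->]; rewrite (le_lt_trans ax).
      by rewrite !in_itv/= => /andP[-> zx]; rewrite (lt_trans zx).
  + exact: measurableI.
  + apply/seteqP; split => // z [] /=; rewrite !in_itv/= => /andP[xz _] [_ /andP[_ zx]].
    by have := lt_trans xz zx; rewrite ltxx.
- rewrite big_cons/=; have := ler_distD (h x) (h y) (h a).
  have : 0 <= e * (y - x) by rewrite mulr_ge0// subr_ge0 ltW.
  lra.
Qed.

Hypothesis ab : a <= b.
Hypothesis loc : forall x, a <= x <= b -> (\forall y \near x, U y) \/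
  (\forall y \near x, `|h y - h x| <= e * `|y - x|).

Let charged_near (x : R) : a <= x <= b -> exists2 r : R, 0 < r &
  forall u v, a <= u -> x - r < u -> u <= x -> x <= v -> v < x + r ->
    (charged u -> charged x) /\ (charged x -> charged v).
Proof.
move=> xab; have [] := loc _ xab => /nbhs_ballP[r /= r0 rP];
  exists r => // u v au xu ux xv vx.
  have UB y : x - r < y -> y < x + r -> U y.
    by move=> ? ?; apply: rP; rewrite /ball/= ltr_distlC; apply/andP; split.
  move: xab => /andP[ax xb]; split.
    move: ux; rewrite le_eqVlt => /predU1P[->//|ux]; apply: charged_open => // z.
    rewrite /= in_itv/= => /andP[uz zx].
    by apply: UB; [exact: lt_trans uz|rewrite (lt_trans zx)// ltrDl].
  move: xv; rewrite le_eqVlt => /predU1P[->//|xv]; apply: charged_open => // z.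
  rewrite /= in_itv/= => /andP[xz zv].
  by apply: UB; [rewrite (lt_trans _ xz)// ltrBlDr ltrDl|exact: lt_trans vx].
have B y : x - r < y -> y < x + r -> `|h y - h x| <= e * `|y - x|.
  by move=> ? ?; apply: rP; rewrite /ball/= ltr_distlC; apply/andP; split.
move: xab => /andP[ax xb]; split.
  apply: charged_rate => //; have := B u xu;
    rewrite distrC (distrC u) [`|x - u|]ger0_norm ?subr_ge0//; apply.
  by rewrite (le_lt_trans ux)// ltrDl.
apply: charged_rate => //; have := B v;
  rewrite [`|v - x|]ger0_norm ?subr_ge0//; apply => //.
by rewrite (lt_le_trans _ xv)// ltrBlDr ltrDl.
Qed.

(** Continuous induction: by [charged_near] the supremum [c] of the charged points is charged, and
    so is a point beyond [c] unless [c = b]. *)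
Lemma charged_end : charged b.
Proof.
pose S := [set x | a <= x <= b /\ charged x].
have Sa : S a.
  split; first by rewrite lexx.
  by exists [::]; split; rewrite //= ?big_nil ?measure_ge0// !subrr normr0 mulr0 addr0.
have Sb : ubound S b by move=> x [/andP[]].
have hS : has_sup S by split; [exists a|exists b].
pose c := sup S.
have ac : a <= c by apply: ub_le_sup => //; exists b.
have cb : c <= b by apply: ge_sup => //; exists a.
have cab : a <= c <= b by rewrite ac.
have [r r0 rP] := charged_near _ cab.
have [u [/andP[au ub] Pu] cu] := sup_adherent r0 hS.
have uc : u <= c by apply: ub_le_sup; [exists b|split; rewrite ?au].
pose v := Num.min b (c + r / 2).
have cv : c <= v by rewrite le_min cb lerDl divr_ge0// ltW.
have vr : v < c + r by rewrite gt_min ltrD2l gtr_pMr// invf_lt1// ltr1n orbT.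
have [uc' cv'] := rP u v au cu uc cv vr.
have Pv := cv' (uc' Pu).
have vc : v <= c.
  apply: ub_le_sup; first by exists b.
  by split => //; rewrite (le_trans ac cv) ge_min lexx.
move: vc; rewrite ge_min [X in _ || X]leNgt ltrDl divr_gt0//= orbF => bc.
have cE : c = b by apply/eqP; rewrite eq_le cb.
by rewrite -cE; exact: uc'.
Qed.

End zero_derivative.

(** Without a quotient the point [y = x] needs no exclusion, and the estimate has the form required
    by [charged_end]. *)
Lemma is_deriveP (R : realType) (f : R -> R) (x l : R) :
  is_derive x 1 f l <-> (forall e, 0 < e ->
    \forall y \near x, `|f y - f x - l * (y - x)| <= e * `|y - x|).
Proof.
split=> [[dfx fxl] e e0|fxl].
  have : (fun h => h^-1 *: ((f \o shift x) (h *: (1 : R)) - f x)) @ 0^' --> l.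
    by rewrite -fxl.
  move=> /cvgrPdist_le /(_ e e0) /nbhs_ballP[r /= r0 rP].
  near=> y; have [->|yx] := eqVneq y x; first by rewrite !subrr mulr0 subrr normr0 mulr0.
  have yx0 : y - x != 0 by rewrite subr_eq0.
  have yxr : `|y - x| < r by near: y; exact: (@cvgr_distC_lt _ _ _ (nbhs x) _ id).
  have := rP (y - x); rewrite /ball/= sub0r normrN => /(_ yxr yx0).
  rewrite /GRing.scale/= mulr1 subrK => H.
  have -> : f y - f x - l * (y - x) = - ((l - (y - x)^-1 * (f y - f x)) * (y - x)).
    by field.
  by rewrite normrN normrM ler_wpM2r.
have lim : (fun h => h^-1 *: ((f \o shift x) (h *: (1 : R)) - f x)) @ 0^' --> l.
  apply/cvgrPdist_le => e e0; have /nbhs_ballP[r /= r0 rP] := fxl e e0.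
  near=> h.
  have h0 : h != 0 by near: h; exact: nbhs_dnbhs_neq.
  have hr : `|h| < r by near: h; exact: dnbhs0_lt.
  rewrite /GRing.scale/= mulr1.
  have := rP (h + x); rewrite /ball/= opprD addrCA subrr addr0 normrN => /(_ hr).
  rewrite addrK => H; rewrite -(ler_pM2r (_ : 0 < `|h|)) ?normr_gt0//.
  have {}H : `|(l - h^-1 * (f (h + x) - f x)) * h| <= e * `|h|.
    have -> : (l - h^-1 * (f (h + x) - f x)) * h = - (f (h + x) - f x - l * h) by field.
    by rewrite normrN.
  by rewrite -normrM.
by split; [apply/cvg_ex; exists l|exact/cvg_lim].
Unshelve. all: by end_near. Qed.

(** A neighbourhood of an interior point lies in [[a, b]], so the limit along [[a, b]] is
    two-sided. *)
Lemma diff_quotient_on_is_derive (R : realType) (a b : R) (f : R -> R) (x l : R) :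
  x \in `]a, b[ -> diff_quotient_on a b f x --> l -> is_derive x 1 f l.
Proof.
move=> xab /cvgrPdist_le fxl; apply/is_deriveP => e e0.
have := fxl e e0; rewrite !near_withinE => H; near=> y.
have [->|yx] := eqVneq y x; first by rewrite !subrr mulr0 subrr normr0 mulr0.
have yx0 : y - x != 0 by rewrite subr_eq0.
have /= : `|l - (f y - f x) / (y - x)| <= e.
  have yab : `[a, b]%classic y.
    have : y \in `]a, b[ by near: y; exact: near_in_itvoo.
    by rewrite /= !in_itv/= => /andP[/ltW -> /ltW ->].
  have : y != x -> `[a, b]%classic y -> `|l - (f y - f x) / (y - x)| <= e by near: y.
  by apply.
have -> : f y - f x - l * (y - x) = - ((l - (f y - f x) / (y - x)) * (y - x)).
  by field.
by rewrite normrN normrM => ?; rewrite ler_wpM2r.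
Unshelve. all: by end_near. Qed.

(* Cover the exceptional null set by an open set U of small measure: the
   variation of h inside U is small by absolute continuity, and outside of U h
   grows at an arbitrarily small rate. *)
Lemma abs_continuous_ae_derive0 (R : realType) (a b : R) (h : R -> R) :
  a <= b -> abs_continuous a b h ->
  {ae (@lebesgue_measure R), forall x, x \in `]a, b[ -> is_derive x 1 h 0} ->
  h b = h a.
Proof.
move=> ab hac [N [mN N0 NP]]; apply/eqP; rewrite -subr_eq0 -normr_le0.
apply/ler_addgt0Pr => e e0; rewrite add0r.
(* Growth at rate [e1] over [[a, b]] contributes at most [e / 2]; the [+ 1] covers [a = b]. *)
pose e1 := e / 2 / (b - a + 1).
have ba1 : 0 < b - a + 1 by rewrite ltr_wpDl// subr_ge0.
have e10 : 0 < e1 by rewrite !divr_gt0.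
have e20 : 0 < e / 2 by rewrite divr_gt0.
have [d d0 dP] := abs_continuous_seq _ _ _ _ _ hac e20.
(* The endpoints join the exceptional set, as the derivative is given on the open interval only. *)
pose N' := N `|` [set a] `|` [set b].
have mN' : measurable N' by apply: measurableU => //; exact: measurableU.
have N'0 : lebesgue_measure N' = 0%E.
  rewrite measureU0//; [|exact: measurableU|exact: lebesgue_measure_set1].
  by rewrite measureU0//; exact: lebesgue_measure_set1.
have [|U [oU N'U Ud]] := lebesgue_regularity_outer mN' _ d0.
  by rewrite [X in (X < _)%E](_ : _ = 0%E) ?ltry.
have mU : measurable U by exact: open_measurable.
have {}Ud : (lebesgue_measure U < d%:E)%E.
  apply: (le_lt_trans _ Ud); have mUN : measurable (U `\` N') by exact: measurableD.
  have E : lebesgue_measure (U `\` N' `|` N') = lebesgue_measure (U `\` N').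
    exact: measureU0.
  apply: (@le_trans _ _ (lebesgue_measure (U `\` N' `|` N'))); last by rewrite E.
  by apply: le_measure; rewrite ?inE//; [exact: measurableU|move=> x Ux;
    have [|] := pselect (N' x); [right|left]].
have loc x : a <= x <= b -> (\forall y \near x, U y) \/
    (\forall y \near x, `|h y - h x| <= e1 * `|y - x|).
  move=> /andP[ax xb]; have [N'x|N'x] := pselect (N' x).
    by left; apply: open_nbhs_nbhs; split => //; exact: N'U.
  right.
  have : is_derive x 1 h 0.
    apply: contrapT => nd; apply: (N'x); left; left; apply: NP => /= H; apply: nd.
    apply: H; rewrite in_itv/= !lt_neqAle ax xb !andbT.
    by apply/andP; split; apply/eqP => E; apply: (N'x); [left; right|right].
  by move=> /is_deriveP /(_ _ e10); apply: filterS => y; rewrite mul0r subr0.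
have [l [l1 l2 l3 l4]] := charged_end a b h U e1 mU (ltW e10) ab loc.
apply: (le_trans l4); rewrite [leRHS](splitr e) lerD//.
  by rewrite /e1 mulrAC ler_pdivrMr// ler_wpM2l ?(ltW e20)// lerDl.
apply/ltW/dP => //; rewrite -lte_fin (le_lt_trans l3)// (le_lt_trans _ Ud)//.
by apply: le_measure; rewrite ?inE//; exact: measurableI.
Qed.

(** * Integration by parts *)

Section integral_primitive.
Context {R : realType}.
Notation mu := (@lebesgue_measure R).
Variables (a b M : R) (psi : R -> R).
Hypotheses (ab : a <= b) (M0 : 0 <= M) (mpsi : measurable_fun `[a, b] psi)
  (psiM : forall x, x \in `[a, b] -> `|psi x| <= M).

Lemma bounded_integrable_itv : mu.-integrable `[a, b] (EFin \o psi).
Proof.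
apply: measurable_bounded_integrable => //.
  by rewrite /= lebesgue_measure_itv/=; case: ifP => _; rewrite -?EFinB ltry.
exists M; split; first exact: num_real.
by move=> N MN x xab; apply: (le_trans (psiM _ _)) => //; exact: ltW.
Qed.

Let psi' := psi \_ `[a, b].

(** Extending [psi] by 0 and integrating from [-oo] gives a primitive on all of [R], to which the
    almost everywhere form of the fundamental theorem of calculus applies. *)
Definition itv_primitive (x : R) : R := \int[mu]_(t in `]-oo, x]) psi' t.

Let ipsi' : mu.-integrable setT (EFin \o psi').
Proof.
rewrite /psi' -restrict_EFin; apply/(integrable_mkcond _ _).1 => //.
exact: bounded_integrable_itv.
Qed.

Let ipsi'S (A : set R) : measurable A -> mu.-integrable A (EFin \o psi').
Proof. by move=> mA; apply: integrableS ipsi'. Qed.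

Let psi'M x : `|psi' x| <= M.
Proof.
rewrite /psi' patchE; case: ifPn => [|_]; last by rewrite normr0.
by rewrite inE => /psiM.
Qed.

Lemma itv_primitiveB (x y : R) : x <= y ->
  itv_primitive y - itv_primitive x = \int[mu]_(t in `]x, y]) psi' t.
Proof. by move=> xy; apply: Rintegral_itvB; rewrite ?bnd_simp//; exact: ipsi'S. Qed.

Lemma itv_primitive_lipschitz (x y : R) : x <= y ->
  `|itv_primitive y - itv_primitive x| <= M * (y - x).
Proof.
move=> xy; rewrite itv_primitiveB//.
apply: (le_trans (le_normr_Rintegral _ _)) => //; first exact: ipsi'S.
have E : \int[mu]_(t in `]x, y]) M = M * (y - x).
  rewrite Rintegral_cst//= lebesgue_measure_itv/= lte_fin.
  move: xy; rewrite le_eqVlt => /predU1P[->|xy]; first by rewrite ltxx subrr.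
  by rewrite xy.
rewrite -E; apply: le_Rintegral => //.
- exact/integrable_norm/ipsi'S.
- apply/integrableP; split; first exact/measurable_EFinP.
  rewrite integral_cst//= lebesgue_measure_itv/=.
  by case: ifP => _; rewrite ?mule0 -?EFinB -?EFinM ltry.
Qed.

Lemma Rintegral_itv_primitive (x y : R) : a <= x -> x <= y -> y <= b ->
  \int[mu]_(t in `[x, y]) psi t = itv_primitive y - itv_primitive x.
Proof.
move=> ax xy yb; rewrite itv_primitiveB// Rintegral_itv_obnd_cbnd; last exact: ipsi'S.
apply: eq_Rintegral => t; rewrite inE/= in_itv/= => /andP[xt ty].
by rewrite /psi' patchE mem_set//= in_itv/= (le_trans ax)// (le_trans ty).
Qed.

Lemma itv_primitive_derive :
  {ae mu, forall x, x \in `[a, b] -> is_derive x 1 itv_primitive (psi x)}.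
Proof.
have loc : locally_integrable [set: R] psi'.
  by apply: integrable_locally_restrict => //; exact: bounded_integrable_itv.
have := FTC1Ny (fun y => ipsi'S _ (measurable_itv _)) loc.
apply: filterS; first exact: (ae_filter_ringOfSetsType mu).
move=> x [dx xE] xab; split; first exact: dx.
by rewrite -derive1E xE /psi' patchE mem_set.
Qed.

End integral_primitive.

Lemma horner_bounded (R : realType) (a b : R) (p : {poly R}) : a <= b ->
  exists2 M, 0 <= M & forall x, x \in `[a, b] -> `|p.[x]| <= M.
Proof.
move=> ab; apply: within_continuous_bounded => //.
by apply: continuous_subspaceT; exact: continuous_horner.
Qed.

Lemma horner_lipschitz (R : realType) (a b M : R) (p : {poly R}) :
  (forall x, x \in `[a, b] -> `|p^`().[x]| <= M) ->
  forall x y, a <= x -> x <= y -> y <= b -> `|p.[y] - p.[x]| <= M * (y - x).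
Proof.
move=> pM x y ax xy yb.
have fx z : z \in `]x, y[ -> is_derive z 1 (horner p) p^`().[z] by move=> _;
  exact: is_derive_poly.
have [|c cxy ->] := MVT_segment xy fx.
  by apply: continuous_subspaceT; exact: continuous_horner.
rewrite normrM [`|y - x|]ger0_norm ?subr_ge0// ler_wpM2r ?subr_ge0//.
apply: pM; move: cxy; rewrite !in_itv/= => /andP[xc cy].
by rewrite (le_trans ax) ?(le_trans cy).
Qed.

(** With [K] a primitive of [f q' + g q], the function [f q - K] is absolutely continuous and has
    derivative 0 almost everywhere, so it takes the same value at [a] and [b]. *)
Lemma abs_continuous_integration_by_parts (R : realType) (a b M : R)
    (f g : R -> R) (q : {poly R}) : a <= b ->
  abs_continuous a b f ->
  measurable_fun `[a, b] g ->
  (forall x, x \in `[a, b] -> `|g x| <= M) ->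
  {ae (@lebesgue_measure R), forall x, x \in `[a, b] ->
     diff_quotient_on a b f x --> g x} ->
  \int[@lebesgue_measure R]_(x in `[a, b]) (f x * q^`().[x]) =
  f b * q.[b] - f a * q.[a] -
  \int[@lebesgue_measure R]_(x in `[a, b]) (g x * q.[x]).
Proof.
move=> ab fac mg gM fg.
have fc := abs_continuous_within_continuous _ _ _ _ fac.
have [Mf Mf0 fM] := within_continuous_bounded _ _ _ _ ab fc.
have mf : measurable_fun `[a, b] f by exact: subspace_continuous_measurable_fun.
have [Q Q0 qQ] := horner_bounded _ _ _ q ab.
have [Q' Q'0 qQ'] := horner_bounded _ _ _ q^`() ab.
have M0 : 0 <= M by apply: le_trans (gM a _) => //; rewrite in_itv/= lexx.
have m1 : measurable_fun `[a, b] (fun x => f x * q^`().[x]).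
  by apply: measurable_funM => //; exact: measurable_poly.
have m2 : measurable_fun `[a, b] (fun x => g x * q.[x]).
  by apply: measurable_funM => //; exact: measurable_poly.
have b1 x : x \in `[a, b] -> `|f x * q^`().[x]| <= Mf * Q'.
  by move=> xab; rewrite normrM ler_pM ?fM ?qQ'.
have b2 x : x \in `[a, b] -> `|g x * q.[x]| <= M * Q.
  by move=> xab; rewrite normrM ler_pM ?gM ?qQ.
pose psi x := f x * q^`().[x] + g x * q.[x].
have mpsi : measurable_fun `[a, b] psi by exact: measurable_funD.
have psiM x : x \in `[a, b] -> `|psi x| <= Mf * Q' + M * Q.
  by move=> xab; rewrite (le_trans (ler_normD _ _))// lerD ?b1 ?b2.
have C0 : 0 <= Mf * Q' + M * Q by rewrite addr_ge0 ?mulr_ge0.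
pose K := itv_primitive a b psi.
have hac : abs_continuous a b (fun x => f x * q.[x] - K x).
  (* [Q] bounds [q], [Mf * Q'] is the bound of [f] times a Lipschitz constant of [q], and the last
     summand is a Lipschitz constant of [K]. *)
  apply: (@abs_continuous_dom _ a b Q (Mf * Q' + (Mf * Q' + M * Q)) f) => //.
    by rewrite addr_ge0// mulr_ge0.
  move=> s t s0 st t0.
  have tab : t \in `[a, b] by rewrite in_itv/= t0 (le_trans s0).
  have sab : s \in `[a, b] by rewrite in_itv/= s0 (le_trans st).
  have -> : f t * q.[t] - K t - (f s * q.[s] - K s) =
      q.[t] * (f t - f s) + f s * (q.[t] - q.[s]) - (K t - K s) by ring.
  rewrite mulrDl addrA.
  apply: (le_trans (ler_normB _ _)); apply: lerD; last first.
    by apply: itv_primitive_lipschitz.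
  apply: (le_trans (ler_normD _ _)); rewrite !normrM; apply: lerD.
    by rewrite ler_wpM2r ?qQ.
  by rewrite -mulrA ler_pM ?fM// (horner_lipschitz _ _ _ _ _ qQ').
have hd : {ae (@lebesgue_measure R), forall x, x \in `]a, b[ ->
    is_derive x 1 (fun x => f x * q.[x] - K x) 0}.
  have kd := itv_primitive_derive _ _ _ _ mpsi psiM.
  apply: (@filterS2 _ _ (ae_filter_ringOfSetsType _)) fg kd => x fx kx xab.
  have xab' : x \in `[a, b].
    by move: xab; rewrite !in_itv/= => /andP[/ltW -> /ltW ->].
  have := diff_quotient_on_is_derive _ _ _ _ _ _ xab (fx xab').
  have := kx xab'; rewrite -/K => dK df.
  apply: trigger_derive; rewrite /GRing.scale/= /psi; ring.
have := abs_continuous_ae_derive0 _ _ _ _ ab hac hd.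
have := Rintegral_itv_primitive _ _ _ _ mpsi psiM a b (lexx _) ab (lexx _).
rewrite -/K RintegralD//; last 2 first.
- exact: bounded_integrable_itv b1.
- exact: bounded_integrable_itv b2.
by move=> E H; lra.
Qed.

(** * Integration against functions of bounded variation *)

(** Over equal cells of length [h] the second order terms add up to [M h (T b - T a)], which tends
    to 0 with [h]. *)
Lemma subdivision_le (R : realType) (a b S M : R) (L T : R -> R) :
  a <= b -> 0 <= M ->
  (forall u v, a <= u -> u <= v -> v <= b ->
    `|L v - L u| <= (S + M * (v - u)) * (T v - T u)) ->
  `|L b - L a| <= S * (T b - T a).
Proof.
move=> ab M0 LT; apply/ler_addgt0Pr => e e0.
pose c := M * (b - a) * (T b - T a).
have [N cN] : exists N : nat, c / e < N.+1%:R.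
  exists (Num.bound `|c / e|); apply: (le_lt_trans (ler_norm _)).
  apply: (lt_le_trans (archi_boundP _)) => //.
  by rewrite ler_nat.
pose h := (b - a) / N.+1%:R.
pose x (j : nat) := a + j%:R * h.
have h0 : 0 <= h by rewrite divr_ge0 ?subr_ge0.
have xS j : x j.+1 - x j = h by rewrite /x -natr1; ring.
have xa j : a <= x j by rewrite lerDl mulr_ge0.
have xN : x N.+1 = b by rewrite /x /h mulrC divfK ?pnatr_eq0//; ring.
have xb j : (j <= N.+1)%N -> x j <= b.
  by move=> jN; rewrite -xN /x lerD2l ler_wpM2r ?ler_nat.
have x0 : x 0%N = a by rewrite /x mul0r addr0.
have step j : (j <= N.+1)%N ->
    `|L (x j) - L a| <= (S + M * h) * (T (x j) - T a).
  elim: j => [_|j IH jN]; first by rewrite x0 !subrr normr0 mulr0.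
  have := LT (x j) (x j.+1) (xa j) _ (xb _ jN).
  rewrite -subr_ge0 xS => /(_ h0); have := IH (ltnW jN).
  have := ler_distD (L (x j)) (L (x j.+1)) (L a); lra.
have := step N.+1 (leqnn _); rewrite xN => /le_trans; apply.
rewrite mulrDl lerD2l.
have -> : M * h * (T b - T a) = c / N.+1%:R by rewrite /h /c; field;
  rewrite nat1r pnatr_eq0.
rewrite ler_pdivrMr// mulrC -ler_pdivrMr//; exact: ltW.
Qed.

(** Composing with the projection of [R] onto [[a, b]] makes [f] monotone on the whole line. *)
Lemma nondecreasing_in_measurable (R : realType) (a b : R) (f : R -> R) :
  a <= b -> {in `[a, b] &, nondecreasing_fun f} -> measurable_fun `[a, b] f.
Proof.
move=> ab fnd; pose clamp x := Num.max a (Num.min x b).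
have clab x : clamp x \in `[a, b].
  by rewrite in_itv/= /clamp le_max lexx/= ge_max ab ge_min lexx orbT.
apply: (eq_measurable_fun (f \o clamp)).
  move=> x; rewrite inE/= in_itv/= => /andP[ax xb].
  by rewrite /clamp /= min_l// max_r.
apply: nondecreasing_measurable => // x y xy; apply: fnd => //.
have mm : Num.min x b <= Num.min y b by rewrite le_min !ge_min xy lexx orbT.
by rewrite /clamp ge_max !le_max lexx mm orbT.
Qed.

Lemma Rintegral_bound (R : realType) (a b M : R) (f : R -> R) :
  a <= b -> 0 <= M -> measurable_fun `[a, b] f ->
  (forall x, x \in `[a, b] -> `|f x| <= M) ->
  `|\int[@lebesgue_measure R]_(x in `[a, b]) f x| <= M * (b - a).
Proof.
move=> ab M0 mf fM; rewrite (Rintegral_itv_primitive _ _ _ _ mf fM)//.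
exact: (itv_primitive_lipschitz _ _ _ _ M0 mf fM).
Qed.

Lemma abs_continuous_cst (R : realType) (a b c : R) : abs_continuous a b (cst c).
Proof.
move=> e e0; exists 1 => // n s t _ _ _.
by rewrite big1// => i _; rewrite subrr normr0.
Qed.

(** Integration by parts against the constant function 1. *)
Lemma Rintegral_deriv_horner (R : realType) (a b : R) (p : {poly R}) : a <= b ->
  \int[@lebesgue_measure R]_(x in `[a, b]) p^`().[x] = p.[b] - p.[a].
Proof.
move=> ab.
have := @abs_continuous_integration_by_parts R a b 0 (cst 1) (cst 0) p ab
  (abs_continuous_cst _ _ _ _).
rewrite !mul1r.
under eq_Rintegral do rewrite mul1r.
under [in X in _ - X]eq_Rintegral do rewrite mul0r.
rewrite Rintegral_cst// mul0r subr0; apply => //.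
- by move=> x _; rewrite normr0.
- apply: aeW => x _; rewrite /diff_quotient_on.
  under eq_fun do rewrite subrr mul0r.
  exact: cvg_cst.
Qed.

Section dominated_increments.
Context {R : realType}.
Notation mu := (@lebesgue_measure R).
Variables (a b : R) (g T : R -> R).
Hypotheses (ab : a <= b)
  (gT : forall u v, a <= u -> u <= v -> v <= b -> `|g v - g u| <= T v - T u).

(** A Jordan decomposition: [T] and [T - g] are both nondecreasing on [[a, b]]. *)
Lemma dominated_increments_measurable : measurable_fun `[a, b] g.
Proof.
rewrite (_ : g = T \- (T \- g)); last by apply/funext => x /=; ring.
apply: measurable_funB; apply: nondecreasing_in_measurable => // u v;
  rewrite !in_itv/= => /andP[au _] /andP[_ vb] uv; have := gT _ _ au uv vb.
  by move=> /(le_trans (normr_ge0 _)); rewrite subr_ge0.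
by move=> /(le_trans (ler_norm _)); rewrite /=; lra.
Qed.

Lemma dominated_increments_bounded (x : R) : x \in `[a, b] ->
  `|g x| <= `|g a| + (T b - T a).
Proof.
rewrite in_itv/= => /andP[ax xb].
have h1 := gT _ _ (lexx a) ax xb.
have h2 := le_trans (normr_ge0 _) (gT _ _ ax xb (lexx b)).
have := ler_distD (g a) (g x) 0; rewrite !subr0; lra.
Qed.

(** Stands in for the bound of the Stieltjes integral of [q] against [dg]. As [q] vanishes at both
    ends, the integral is the increment of [K - g q] over [[a, b]]. *)
Lemma dominated_increments_integral (S : R) (q : {poly R}) :
  q.[a] = 0 -> q.[b] = 0 -> (forall x, x \in `[a, b] -> `|q.[x]| <= S) ->
  `|\int[mu]_(x in `[a, b]) (g x * q^`().[x])| <= S * (T b - T a).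
Proof.
move=> qa qb qS.
have [M M0 qM] := horner_bounded _ _ _ q^`() ab.
pose G := `|g a| + (T b - T a).
have mg := dominated_increments_measurable.
have mpsi : measurable_fun `[a, b] (fun x => g x * q^`().[x]).
  by apply: measurable_funM => //; exact: measurable_poly.
have psiM x : x \in `[a, b] -> `|g x * q^`().[x]| <= G * M.
  by move=> xab; rewrite normrM ler_pM ?qM// dominated_increments_bounded.
pose K := itv_primitive a b (fun x => g x * q^`().[x]).
have KE := Rintegral_itv_primitive _ _ _ _ mpsi psiM.
have -> : \int[mu]_(x in `[a, b]) (g x * q^`().[x]) =
    (K b - g b * q.[b]) - (K a - g a * q.[a]).
  by rewrite qa qb !mulr0 !subr0 KE.
(* K - g q has increments at most S |T v - T u|, up to second order terms. *)
apply: (@subdivision_le R a b S M (fun x => K x - g x * q.[x]) T) => //.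
move=> u v au uv vb.
have uvab x : x \in `[u, v] -> x \in `[a, b].
  by rewrite !in_itv/= => /andP[ux xv]; rewrite (le_trans au)// (le_trans xv).
have sub : `[u, v] `<=` `[a, b] by exact: uvab.
have mg' : measurable_fun `[u, v] g by exact: measurable_funS mg.
have T0 : 0 <= T v - T u := le_trans (normr_ge0 _) (gT _ _ au uv vb).
(* On a cell [g] is replaced by its value at the right end, with error at most [T v - T u]. *)
have cell : `|K v - K u - g v * (q.[v] - q.[u])| <= (T v - T u) * M * (v - u).
  rewrite -KE// -Rintegral_deriv_horner// -RintegralZl//; last first.
    apply: bounded_integrable_itv => [|x /uvab]; last exact: qM.
    exact: measurable_poly.
  rewrite -RintegralB//; last 2 first.
  - apply: (@bounded_integrable_itv _ _ _ (G * M)) => [|x /uvab]; last exact: psiM.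
    exact: measurable_funS mpsi.
  - apply: (@bounded_integrable_itv _ _ _ (`|g v| * M)) => [|x /uvab xab]; last first.
      by rewrite normrM ler_wpM2l// qM.
    by apply: measurable_funM => //; exact: measurable_poly.
  apply: Rintegral_bound => //; first by rewrite mulr_ge0.
    apply: measurable_funB; apply: measurable_funM => //; exact: measurable_poly.
  move=> x xuv; rewrite -mulrBl normrM ler_pM ?qM ?uvab//.
  move: xuv; rewrite in_itv/= => /andP[ux xv].
  have h1 := gT _ _ (le_trans au ux) xv vb.
  have h2 := le_trans (normr_ge0 _) (gT _ _ au ux (le_trans xv vb)).
  by rewrite distrC; lra.
have -> : K v - g v * q.[v] - (K u - g u * q.[u]) =
  (K v - K u - g v * (q.[v] - q.[u])) - q.[u] * (g v - g u) by ring.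
rewrite mulrDl [leRHS]addrC; apply: (le_trans (ler_normB _ _)); apply: lerD.
  by rewrite (le_trans cell)// le_eqVlt; apply/orP; left; apply/eqP; ring.
by rewrite normrM ler_pM ?gT// qS// in_itv/= au (le_trans uv).
Qed.

End dominated_increments.

(** By additivity of the variation, the variation over [[a, x]] can serve as the dominating function
    [T]. *)
Lemma bounded_variation_increments (R : realType) (a b : R) (g : R -> R) :
  bounded_variation a b g -> forall u v, a <= u -> u <= v -> v <= b ->
  `|g v - g u| <= fine (total_variation a v g) - fine (total_variation a u g).
Proof.
move=> gbv u v au uv vb; have av := le_trans au uv.
have fv : total_variation a v g \is a fin_num.
  by apply/bounded_variationP => //; exact: bounded_variationl gbv.
have fu : total_variation a u g \is a fin_num.
  apply/bounded_variationP => //.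
  by apply: bounded_variationl gbv => //; exact: le_trans vb.
have := total_variationD g au uv.
have := total_variation_ge g uv.
rewrite -[X in (X = _)%E -> _]fineK// -{1}(fineK fu).
move=> h; case: (total_variation u v g) h => [r||] //.
by rewrite lee_fin => h [->]; rewrite addrAC subrr add0r.
Qed.

(** * Legendre coefficients *)

Lemma legendre_coef_bounded_variation (R : realType) (g : R -> R) (n : nat) :
  bounded_variation (-1) 1 g -> (0 < n)%N ->
  `|legendre_coef g n| <=
    2 * fine (total_variation (-1) 1 g) / Num.sqrt (2 * pi * n%:R).
Proof.
move=> gbv n0; have N11 : -1 <= 1 :> R by lra.
have h0 : 0 < n%:R + 2^-1 :> R by rewrite ltr_wpDl.
have QS x : x \in `[-1, 1] -> `|(legendre_primitive R n).[x]| <=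
    2 / Num.sqrt (2 * pi * n%:R) / (n%:R + 2^-1).
  by rewrite in_itv/= => x11; rewrite ler_pdivlMr// mulrC legendre_primitive_le.
have := dominated_increments_integral _ _ _ _ N11
  (bounded_variation_increments _ _ _ _ gbv) _ _ _ _ QS.
rewrite !legendre_primitive_at_pm1 ?expr1n ?sqrrN ?expr1n// => /(_ erefl erefl).
rewrite deriv_legendre_primitive// total_variationxx subr0 => H.
rewrite /legendre_coef normrM gtr0_norm// -ler_pdivlMl//.
by apply: (le_trans H); rewrite le_eqVlt; apply/orP; left; apply/eqP; ring.
Qed.

Lemma legendre_coef_rec (R : realType) (f g : R -> R) (M : R) (n : nat) :
  (0 < n)%N ->
  abs_continuous (-1) 1 f -> measurable_fun (`[-1, 1] : set R) g ->
  (forall x, x \in `[-1, 1] -> `|g x| <= M) ->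
  {ae (@lebesgue_measure R), forall x, x \in `[-1, 1] ->
     diff_quotient_on (-1) 1 f x --> g x} ->
  legendre_coef f n = legendre_coef g n.-1 / (2 * n%:R - 1) -
    legendre_coef g n.+1 / (2 * n%:R + 3).
Proof.
move=> n0 fac mg gM fg; have N11 : -1 <= 1 :> R by lra.
have int k : (@lebesgue_measure R).-integrable `[-1, 1]
    (EFin \o (fun x => g x * (legendre R k).[x])).
  have [P P0 kP] := horner_bounded _ _ _ (legendre R k) N11.
  apply: (@bounded_integrable_itv _ _ _ (M * P)).
    by apply: measurable_funM => //; exact: measurable_poly.
  by move=> x x11; rewrite normrM ler_pM ?gM ?kP.
have := abs_continuous_integration_by_parts _ _ _ _ _ _ (legendre_primitive R n)
  N11 fac mg gM fg.
rewrite !legendre_primitive_at_pm1 ?expr1n ?sqrrN ?expr1n// !mulr0 subrr sub0r.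
rewrite deriv_legendre_primitive// => E.
rewrite /legendre_coef E.
have n2 : (2 * n + 1)%:R != 0 :> R by rewrite addn1 pnatr_eq0.
have -> : legendre_primitive R n =
    (2 * n + 1)%:R^-1 *: (legendre R n.+1 - legendre R n.-1).
  by rewrite -legendre_primitive_rec// scalerA mulVf// scale1r.
under eq_Rintegral do rewrite hornerZ hornerD hornerN mulrCA mulrBr.
rewrite RintegralZl//; last first.
  by apply: (eq_integrable _ _ _ _ (integrableB _ (int n.+1) (int n.-1))).
rewrite RintegralB//.
(* The factor [(n + 1/2) / (2n + 1)] is [1/2], and half the integral of [g P_k] is the coefficient
   of index [k] divided by [2k + 1], for [k = n - 1] and [k = n + 1]. *)
case: n n0 {E} n2 => // n _ n2.
move: (\int[_]_(_ in _) _) (\int[_]_(_ in _) _) => I J.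
rewrite natrD natrM -(natr1 n.+1) -(natr1 n).
have : 0 <= n%:R :> R by [].
move: n%:R => N N0; field.
by rewrite !gt_eqF//; lra.
Qed.

(** * The bound and the induction on the order of differentiation *)

Definition legendre_bound (R : realType) (V : R) (m n : nat) : R :=
  2 * V / Num.sqrt (2 * pi * (n%:R - m%:R)) *
    \prod_(1 <= k < m.+1) (n%:R - k%:R + 2^-1)^-1.

(** Raising both indices preserves [n - m] and shifts the product, adding only the factor for
    [k = 1]. *)
Lemma legendre_boundS (R : realType) (V : R) (m n : nat) :
  legendre_bound R V m.+1 n.+1 = legendre_bound R V m n / (n%:R + 2^-1).
Proof.
rewrite /legendre_bound big_ltn// big_add1/=.
rewrite (_ : n.+1%:R - m.+1%:R = n%:R - m%:R :> R); last by rewrite -!natr1; ring.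
rewrite (_ : n.+1%:R - 1 = n%:R :> R); last by rewrite -natr1; ring.
rewrite mulrCA mulrC; congr (_ * _ * _); apply: eq_bigr => k _.
by congr (_ + _)^-1; rewrite -!natr1; ring.
Qed.

(** Lets the coefficient of index [n + 1] in the recurrence share the bound of the one of index
    [n - 1]. *)
Lemma legendre_bound_nincr (R : realType) (V : R) (m n : nat) : 0 <= V ->
  (m < n)%N -> legendre_bound R V m n.+1 <= legendre_bound R V m n.
Proof.
move=> V0 mn.
have kn k : (k < m.+1)%N -> 0 < n%:R - k%:R + 2^-1 :> R.
  by move=> km; rewrite ltr_wpDl// subr_ge0 ler_nat (leq_trans _ mn)// ltnW.
have nm : 0 < n%:R - m%:R :> R by rewrite subr_gt0 ltr_nat.
apply: ler_pM.
- by rewrite divr_ge0 ?sqrtr_ge0// mulr_ge0.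
- rewrite big_nat prodr_ge0// => k /andP[_ km]; rewrite invr_ge0.
  by rewrite (le_trans (ltW (kn k km)))// -natr1; lra.
- rewrite ler_wpM2l ?mulr_ge0// lef_pV2 ?posrE ?sqrtr_gt0 ?mulr_gt0 ?pi_gt0//.
    by rewrite ler_wsqrtr// ler_pM2l ?mulr_gt0 ?pi_gt0// -natr1; lra.
  by rewrite -natr1; lra.
- rewrite !big_nat; apply: ler_prod => k /andP[_ km].
  have k0 := kn k km.
  have k1 : 0 < n.+1%:R - k%:R + 2^-1 :> R by rewrite -natr1; lra.
  by rewrite invr_ge0 (ltW k1)/= lef_pV2// -natr1; lra.
Qed.

Lemma nderive_on_derive (R : realType) (a b : R) (k : nat) (f : R -> R) :
  nderive_on a b k (derive_on a b f) = nderive_on a b k.+1 f.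
Proof. by rewrite /nderive_on iterSr. Qed.

Lemma legendre_coef_le (R : realType) (m : nat) (f g : R -> R)
    (f_der : forall k : nat, (k.+1 < m)%N ->
       derivable_on (-1) 1 (nderive_on (-1) 1 k f))
    (f_ac : forall k : nat, (k < m)%N ->
       abs_continuous (-1) 1 (nderive_on (-1) 1 k f))
    (g_der : is_nderive_ae (-1) 1 m f g)
    (g_bv : bounded_variation (-1) 1 g)
    (n : nat) (mn : (m.+1 <= n)%N) :
  `|legendre_coef f n| <= legendre_bound R (fine (total_variation (-1) 1 g)) m n.
Proof.
have N11 : -1 <= 1 :> R by lra.
elim: m f f_der f_ac g_der n mn => [|m IH] f f_der f_ac g_der n mn.
  rewrite /legendre_bound big_geq// mulr1 subr0.
  rewrite (_ : legendre_coef f n = legendre_coef g n).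
    exact: legendre_coef_bounded_variation.
  congr (_ * _); apply: eq_Rintegral => x; rewrite inE/= => x11.
  by rewrite g_der.
set V := fine _ in IH *.
have V0 : 0 <= V by rewrite fine_ge0// total_variation_ge0.
have fac : abs_continuous (-1) 1 f by exact: (f_ac 0%N).
(* [phi] is a bounded representative of [f']: [g] itself if only one derivative is taken, otherwise
   the everywhere defined derivative, which is continuous. *)
have [phi [M [mphi phiM fphi IHphi]]] : exists phi : R -> R, exists M : R,
  [/\ measurable_fun (`[-1, 1] : set R) phi, forall x, x \in `[-1, 1] -> `|phi x| <= M,
      {ae (@lebesgue_measure R), forall x, x \in `[-1, 1] ->
        diff_quotient_on (-1) 1 f x --> phi x} &
      forall n, (m < n)%N -> `|legendre_coef phi n| <= legendre_bound R V m n].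
  case: m IH f_der f_ac g_der {mn} => [|m] IH f_der f_ac g_der.
    exists g; have gT := bounded_variation_increments _ _ _ _ g_bv.
    eexists; split.
    - exact: dominated_increments_measurable gT.
    - exact: dominated_increments_bounded gT.
    - exact: g_der.
    - by apply: IH => //.
  have cphi := abs_continuous_within_continuous _ _ _ _ (f_ac 1%N isT).
  have [M M0 phiM] := within_continuous_bounded _ _ _ _ N11 cphi.
  exists (derive_on (-1) 1 f), M; split => //.
  - exact: subspace_continuous_measurable_fun.
  - by apply: aeW => x x11; exact: (f_der 0%N).
  apply: IH => [k km|k km|].
  - by rewrite nderive_on_derive; exact: f_der.
  - by rewrite nderive_on_derive; exact: f_ac.
  - by move: g_der; rewrite /is_nderive_ae nderive_on_derive.
(* The index becomes [n.+1], so the recurrence involves the indices [n] and [n.+2], both above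
   [m]. *)
case: n mn => // n mn; rewrite ltnS in mn.
rewrite (legendre_coef_rec _ _ _ _ _ _ fac mphi phiM fphi)//= legendre_boundS.
have n0 : 1 <= n%:R :> R by rewrite ler1n (leq_ltn_trans _ mn).
have a1 := IHphi n mn.
have a2 := IHphi n.+2 (leq_trans mn (leq_trans (leqnSn _) (leqnSn _))).
have {}a2 : `|legendre_coef phi n.+2| <= legendre_bound R V m n.
  apply: (le_trans a2); apply: (@le_trans _ _ (legendre_bound R V m n.+1)).
    by apply: legendre_bound_nincr => //; exact: leqW.
  exact: legendre_bound_nincr.
apply: (le_trans (ler_normB _ _)); rewrite ![`|legendre_coef _ _ / _|]normrM !normfV.
have d1 : 2 * n.+1%:R - 1 = 2 * (n%:R + 2^-1) :> R by rewrite -natr1; field.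
have d2 : 2 * (n%:R + 2^-1) <= 2 * n.+1%:R + 3 :> R by rewrite -(natr1 n); lra.
have p1 : 0 < 2 * (n%:R + 2^-1) :> R by lra.
rewrite d1 [`|2 * (_ + _)|]gtr0_norm// [`|_ + 3|]gtr0_norm; last exact: lt_le_trans d2.
(* The two denominators, [2n + 1] and [2n + 5], are at least [2 (n + 1/2)], so each term takes one
   half of the bound. *)
have -> : legendre_bound R V m n / (n%:R + 2^-1) =
  legendre_bound R V m n / (2 * (n%:R + 2^-1)) + legendre_bound R V m n / (2 *
    (n%:R + 2^-1)).
  have : n%:R + 2^-1 != 0 :> R by rewrite gt_eqF//; lra.
  by move: (n%:R + 2^-1) => d d0; field.
apply: lerD; first by rewrite ler_pM2r ?invr_gt0.
apply: ler_pM => //.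
by rewrite lef_pV2// posrE (lt_le_trans p1).
Qed.

Theorem theorem3p1 (R : realType) (m : nat) (f g : R -> R)
    (f_der : forall k : nat, (k.+1 < m)%N ->
       derivable_on (-1) 1 (nderive_on (-1) 1 k f))
    (f_ac : forall k : nat, (k < m)%N ->
       abs_continuous (-1) 1 (nderive_on (-1) 1 k f))
    (g_der : is_nderive_ae (-1) 1 m f g)
    (g_bv : bounded_variation (-1) 1 g)
    (n : nat) (mn : (m.+1 <= n)%N) :
  `|legendre_coef f n| <=
    2 * fine (total_variation (-1) 1 g) / Num.sqrt (2 * pi * (n%:R - m%:R)) *
    \prod_(1 <= k < m.+1) (n%:R - k%:R + 2^-1)^-1.
Proof. exact: legendre_coef_le. Qed.
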